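(* Let $n \geq 2^{13}$ and let $G$ be a graph on $n$ vertices with at least one universal vertex. Then the domination polynomial $D(G,x)$ is unimodal. Furthermore, the mode of $D(G,x)$ lies in the interval $[n/2,\ n/2 + \log_2 n + 2]$.
   Context: All graphs are finite, undirected and simple. For a graph $G=(V,E)$ on $n$ vertices and $S \subseteq V$, the (closed) neighborhood $N(S)$ is the set of vertices that are either in $S$ or adjacent to a vertex of $S$. A set $S$ is dominating if $N(S)=V$. Let $d_i(G)$ be the number of $i$-element dominating vertex sets of $G$; the domination polynomial is $D(G,x)=\sum_{i=1}^n d_i(G)x^i$. A vertex $v$ is universal if $N(\{v\})=V$, i.e. $v$ is adjacent to every other vertex. A polynomial $f(x)=\sum_{i=0}^n a_i x^i$ is unimodal if there is $k\in[0,n]$ with $a_i \le a_{i+1}$ for all $i<k$ and $a_i \ge a_{i+1}$ for all $i \ge k$; the largest such $k$ is called the mode of $f$. *)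

(* Defs.v *)
From mathcomp Require Export all_boot all_order all_algebra.
From mathcomp Require Export reals exp.

Set Implicit Arguments.
Unset Strict Implicit.
Unset Printing Implicit Defensive.

Import Order.TTheory GRing.Theory Num.Theory.
Local Open Scope ring_scope.

Section Domination.
Variables (V : finType) (adj : rel V).

Definition closed_nbhd (S : {set V}) : {set V} :=
  [set v | (v \in S) || [exists u in S, adj u v]].

Definition dominating (S : {set V}) : bool := closed_nbhd S == [set: V].

Definition universal (v : V) : bool := closed_nbhd [set v] == [set: V].

Definition dom_count (i : nat) : nat :=
  #|[set S : {set V} | dominating S & #|S| == i]|.

Definition dom_poly : {poly int} :=
  \sum_(1 <= i < #|V|.+1) (dom_count i)%:R *: 'X^i.

End Domination.

Section Unimodality.
Variables (R : numDomainType) (f : {poly R}).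

(* The coefficient sequence is a_0, ..., a_n with n = (size f).-1 the degree
   of f, so the descent condition compares a_i and a_(i+1) for k <= i < n. *)
Definition unimodal_at (k : nat) : Prop :=
  [/\ (k <= (size f).-1)%N,
      forall i, (i < k)%N -> f`_i <= f`_i.+1
    & forall i, (k <= i < (size f).-1)%N -> f`_i.+1 <= f`_i].

Definition unimodal : Prop := exists k, unimodal_at k.

Definition is_mode (k : nat) : Prop :=
  unimodal_at k /\ forall j, unimodal_at j -> (j <= k)%N.

End Unimodality.

Definition log2 (R : realType) (x : R) : R := ln x / ln 2.

(* Main.v *)
(* Let N w be the closed neighbourhoods, d_i the number of i-sets S meeting all of
   them, and Q_i the number of pairs (S, v) with S an i-set such that S fails to
   meet all of them but v |: S does. Counting pairs (S, v |: S) gives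
     (i + 1) d_{i+1} = (n - i) d_i + Q_i,
   hence d_i <= d_{i+1} as long as 2 i < n. The universal vertex lies in every N w,
   so 2 d_i >= 'C(n, i) when 2 i >= n. Call N w small if it has at most
   D = 2 floor(log_2 n) elements: few sets of size at least n / 2 miss a large one,
   and a set missing a small one has at most D pivotal vertices. So Q_i is at most
   D times the number of nondominating sets plus 'C(n, i) / 4, which forces a
   strict descent once 2 i >= n + D. In the remaining window of length O(log n),
   bounding the increment of Q_i in the same way shows that a descent at i is
   followed by a descent at i + 1. *)
Require Import Defs.
From mathcomp Require Import zify lra.
Set Implicit Arguments.
Unset Strict Implicit.

Import Order.TTheory GRing.Theory Num.Theory.
Local Open Scope ring_scope.

(** * Hitting sets of a family of vertex sets, counted by size *)

Section HittingSets.
Local Open Scope nat_scope.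
Variables (V : finType) (N : V -> {set V}).
Implicit Types (S T : {set V}) (a v w : V).

Definition hits S := [forall w, ~~ [disjoint S & N w]].

Definition pivotal S v := ~~ hits S && hits (v |: S).

Definition hit_count i := \sum_(S : {set V} | #|S| == i) hits S.

Definition pivot_count i := \sum_(S : {set V} | #|S| == i) \sum_v pivotal S v.

Lemma hitsPn S : reflect (exists w, [disjoint S & N w]) (~~ hits S).
Proof.
apply: (iffP forallPn) => -[w]; first by rewrite negbK; exists w.
by move=> dw; exists w; rewrite negbK.
Qed.

Lemma hitsU1 S a : hits S -> hits (a |: S).
Proof.
move/forallP=> hS; apply/forallP=> w; apply: contra (hS w).
by apply: disjointWl; apply: subsetUr.
Qed.

Lemma disjointU1 S a w :
  [disjoint a |: S & N w] = (a \notin N w) && [disjoint S & N w].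
Proof. by rewrite !disjoints_subset subUset sub1set inE. Qed.

Lemma pivotal_notin S v : pivotal S v -> v \notin S.
Proof.
case/andP=> nS hS; apply: contraNN nS => vS.
by rewrite (_ : S = v |: S) //; apply/esym/setUidPr; rewrite sub1set.
Qed.

Lemma hits_add_mem S v w : hits (v |: S) -> [disjoint S & N w] -> v \in N w.
Proof.
move/forallP/(_ w); rewrite disjointU1 negb_and negbK => /orP[//|].
by move/negP.
Qed.

(** The bijection behind it sends [(S, v)] with [v \notin S] to [(v |: S, v)]; its inverse sends
    [(T, v)] with [v \in T] to [(T :\ v, v)]. *)
Lemma double_count (F : {set V} -> V -> nat) i :
  \sum_(S : {set V} | #|S| == i) \sum_(v | v \notin S) F (v |: S) v
  = \sum_(T : {set V} | #|T| == i.+1) \sum_(v | v \in T) F T v.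
Proof.
rewrite (exchange_big_dep xpredT) //= [RHS](exchange_big_dep xpredT) //=.
apply: eq_bigr => v _.
rewrite [RHS](reindex_onto (fun S => v |: S) (fun T => T :\ v)) /=; last first.
  by move=> T /andP[_ vT]; rewrite setD1K.
apply: eq_bigl => S; rewrite setU11 andbT.
case: (boolP (v \in S)) => vS /=.
  rewrite andbF; apply/esym/negbTE; apply/negP => /andP[_ /eqP e].
  by move: vS; rewrite -e !inE eqxx.
by rewrite setU1K // eqxx !andbT cardsU1 vS add1n eqSS.
Qed.

Lemma hit_count_succ i :
  i <= #|V| ->
  i.+1 * hit_count i.+1 = (#|V| - i) * hit_count i + pivot_count i.
Proof.
move=> le_in; rewrite /hit_count !big_distrr /=.
transitivity (\sum_(T : {set V} | #|T| == i.+1) \sum_(v | v \in T) hits T).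
  by apply: eq_bigr => T /eqP <-; rewrite sum_nat_const.
rewrite -(double_count (fun T _ => hits T)) /pivot_count -big_split /=.
apply: eq_bigr => S /eqP cS.
have -> : #|V| - i = \sum_(v | v \notin S) 1.
  by rewrite sum1_card -cS -(cardC S) addKn; apply: eq_card.
rewrite big_distrl /= [X in _ + X](bigID (fun v => v \notin S)) /=.
rewrite [X in _ + (_ + X)]big1 ?addn0; last first.
  move=> v; rewrite negbK => vS.
  by case: (boolP (pivotal S v)) => // /pivotal_notin; rewrite vS.
rewrite -big_split /=; apply: eq_bigr => v _; rewrite mul1n /pivotal.
case: (boolP (hits S)) => [/(hitsU1 v) -> //|_]; by rewrite add0n.
Qed.

(* Exactly the pairs (a, v) for which v is pivotal for a |: S but not for S. *)
Definition double_pivotal S a v :=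
  [&& ~~ hits (a |: S), ~~ hits (v |: S) & hits (v |: (a |: S))].

Definition double_pivot_count i :=
  \sum_(S : {set V} | #|S| == i) \sum_(a | a \notin S) \sum_(v | v \notin S)
    double_pivotal S a v.

(** Let [v] be pivotal for [T] and delete each [a] of [T] in turn: either [v] stays pivotal for
    [T :\ a], or [v |: (T :\ a)] no longer hits and the pair is double pivotal. *)
Lemma pivot_count_succ i :
  i <= #|V| ->
  i.+1 * pivot_count i.+1 <= (#|V| - i) * pivot_count i + double_pivot_count i.
Proof.
move=> le_in.
have -> : i.+1 * pivot_count i.+1
    = \sum_(S : {set V} | #|S| == i) \sum_(a | a \notin S) \sum_v
        pivotal (a |: S) v.
  rewrite (double_count (fun T _ => \sum_v pivotal T v)) /pivot_count.
  by rewrite big_distrr; apply: eq_bigr => T /eqP <-; rewrite sum_nat_const.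
rewrite /pivot_count /double_pivot_count big_distrr -big_split /=.
apply: leq_sum => S /eqP cS.
have -> : #|V| - i = \sum_(v | v \notin S) 1.
  by rewrite sum1_card -cS -(cardC S) addKn; apply: eq_card.
rewrite big_distrl -big_split /=; apply: leq_sum => a aS.
rewrite mul1n [X in _ <= _ + X]big_mkcond -big_split /=.
apply: leq_sum => v _; rewrite /pivotal /double_pivotal.
case: (boolP (hits (a |: S))) => //= nha.
have -> : ~~ hits S by apply: contra nha; apply: hitsU1.
case: (boolP (v \in S)) => vS /=.
  rewrite (_ : v |: (a |: S) = a |: S) ?(negbTE nha) //.
  by apply/setUidPr; rewrite sub1set !inE vS orbT.
by case: (hits (v |: S)); case: (hits _).
Qed.

(** * Locating pivotal vertices in small or large missed sets *)

Lemma sum_draws_disjoint (A : {set V}) i :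
  \sum_(S : {set V} | #|S| == i) [disjoint S & A] = 'C(#|V| - #|A|, i).
Proof.
have -> : #|V| - #|A| = #|~: A| by rewrite -(cardsC A) addKn.
rewrite -cards_draws -big_mkcondr sum1dep_card /=.
by apply: eq_card => S; rewrite !inE disjoints_subset andbC.
Qed.

Lemma sum_draws i : \sum_(S : {set V} | #|S| == i) 1 = 'C(#|V|, i).
Proof. by rewrite sum1dep_card card_draws. Qed.

(* A vertex pivotal for S lies in every N w missed by S, so one missed N w of
   size at most D confines all of them. *)
Definition small_edge D S : {set V} :=
  if [pick w | [disjoint S & N w] && (#|N w| <= D)] is Some w then N w
  else set0.

Lemma card_small_edge D S : #|small_edge D S| <= D.
Proof. by rewrite /small_edge; case: pickP => [w /andP[]|_] //; rewrite cards0. Qed.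

Variant small_edge_spec D S : {set V} -> Prop :=
  | SmallEdge w of [disjoint S & N w] & #|N w| <= D : small_edge_spec D S (N w)
  | NoSmallEdge of (forall w, [disjoint S & N w] -> D < #|N w|) :
      small_edge_spec D S set0.

Lemma small_edgeP D S : small_edge_spec D S (small_edge D S).
Proof.
rewrite /small_edge; case: pickP => [w /andP[dw leD]|nw]; constructor => // w dw.
by move: (nw w); rewrite dw /= leqNgt => /negbFE.
Qed.

(** A multiplicity rather than a boolean, so that summing over [S] and [v] gives an exact binomial
    sum. *)
Definition large_miss D S v :=
  \sum_(w | D < #|N w|) [disjoint S & N w] * (v \in N w).

Definition large_miss_count D i :=
  \sum_(S : {set V} | #|S| == i) \sum_v large_miss D S v.

Lemma large_miss_gt0 D S v w :
  D < #|N w| -> [disjoint S & N w] -> v \in N w -> 0 < large_miss D S v.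
Proof. by move=> Dw dw vw; rewrite /large_miss (bigD1 w) //= dw vw. Qed.

Lemma pivotal_small_or_large D S v :
  pivotal S v -> (v \in small_edge D S) || (0 < large_miss D S v).
Proof.
case/andP=> /hitsPn[w0 dw0] hv.
case: small_edgeP => [w dw _|large]; first by rewrite (hits_add_mem hv dw).
by rewrite (large_miss_gt0 (large _ dw0) dw0 (hits_add_mem hv dw0)) orbT.
Qed.

Lemma pivotal_le D S v :
  pivotal S v <= ~~ hits S * (v \in small_edge D S) + large_miss D S v.
Proof.
case: (boolP (pivotal S v)) => // piv; case/orP: (pivotal_small_or_large D piv).
  by move=> ->; case/andP: piv => ->.
by move=> lt0; apply: leq_trans lt0 (leq_addl _ _).
Qed.

(** Without large misses, [v] lies in the small edge of [a |: S] and [a] in that of [v |: S]. Adding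
    both vertices hits the small edge of [S], so this edge contains one of them. *)
Lemma double_pivotal_le D S a v :
  double_pivotal S a v <=
    ((v \in small_edge D S) * (a \in small_edge D (v |: S))
     + (a \in small_edge D S) * (v \in small_edge D (a |: S)))
    + (large_miss D (a |: S) v + large_miss D (v |: S) a).
Proof.
case: (boolP (double_pivotal S a v)) => // /and3P[na nv hav].
have hva : hits (a |: (v |: S)) by rewrite setUCA.
have pv : pivotal (a |: S) v by rewrite /pivotal na.
have pa : pivotal (v |: S) a by rewrite /pivotal nv.
case/orP: (pivotal_small_or_large D pv) => [vE|]; last by lia.
case/orP: (pivotal_small_or_large D pa) => [aE|]; last by lia.
rewrite vE aE !muln1.
suff : (v \in small_edge D S) || (a \in small_edge D S).
  by case: (v \in small_edge D S) => //= ->; rewrite add0n.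
case: (small_edgeP D S) => [w dw _|large].
  case: (boolP (a \in N w)) => [_|aw]; first by rewrite orbT.
  by rewrite (hits_add_mem hav) // disjointU1 aw.
(* A small edge missed by [a |: S] is missed by [S] as well, so [S] cannot miss only large ones. *)
case: (small_edgeP D (a |: S)) vE => [w dw leD|_]; last by rewrite inE.
by move: dw; rewrite disjointU1 => /andP[_ /large]; rewrite ltnNge leD.
Qed.

Lemma pivot_count_le D i :
  pivot_count i
    <= D * \sum_(S : {set V} | #|S| == i) ~~ hits S + large_miss_count D i.
Proof.
rewrite big_distrr -big_split; apply: leq_sum => S _ /=.
apply: (@leq_trans (\sum_v (~~ hits S * (v \in small_edge D S)
    + large_miss D S v))); first by apply: leq_sum => v _; apply: pivotal_le.
rewrite big_split leq_add2r -big_distrr /= mulnC leq_mul2r.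
by rewrite -big_mkcond sum1_card card_small_edge orbT.
Qed.

Lemma double_pivot_count_le D i :
  double_pivot_count i
    <= 2 * (D * D) * 'C(#|V|, i) + 2 * (i.+1 * large_miss_count D i.+1).
Proof.
pose E S : nat := \sum_a \sum_v (v \in small_edge D S) * (a \in small_edge D (v |: S)).
have le_E S : E S <= D * D.
  (* The edge confining [a] depends on [v], so [v] is summed outside: at most [D] choices of [v],
     then [D] of [a]. *)
  rewrite /E exchange_big /=.
  apply: (@leq_trans (\sum_v (v \in small_edge D S) * D)).
    apply: leq_sum => v _; rewrite -big_distrr leq_mul2l /=.
    by rewrite -big_mkcond sum1_card card_small_edge orbT.
  rewrite -big_distrl leq_mul2r /=.
  by rewrite -big_mkcond sum1_card card_small_edge orbT.
pose F S : nat := \sum_(a | a \notin S) \sum_v large_miss D (a |: S) v.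
have sumF : \sum_(S : {set V} | #|S| == i) F S = i.+1 * large_miss_count D i.+1.
  rewrite (double_count (fun T _ => \sum_v large_miss D T v)) /large_miss_count.
  by rewrite big_distrr; apply: eq_bigr => T /eqP <-; rewrite sum_nat_const.
have le_S S : \sum_(a | a \notin S) \sum_(v | v \notin S) double_pivotal S a v
    <= 2 * (D * D) + 2 * F S.
  have sub_sum (P : pred V) (G : V -> nat) : \sum_(a | P a) G a <= \sum_a G a.
    by rewrite big_mkcond leq_sum // => a _; case: ifP.
  have le2 : \sum_(a | a \notin S) \sum_(v | v \notin S) large_miss D (v |: S) a <= F S.
    by rewrite exchange_big; apply: leq_sum => v _; apply: sub_sum.
  have le1 : \sum_(a | a \notin S) \sum_(v | v \notin S) large_miss D (a |: S) v <= F S.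
    by apply: leq_sum => v _; apply: sub_sum.
  have le3 : \sum_(a | a \notin S) \sum_(v | v \notin S)
      (v \in small_edge D S) * (a \in small_edge D (v |: S)) <= E S.
    by apply: leq_trans (sub_sum _ _) _; apply: leq_sum => v _; apply: sub_sum.
  have le4 : \sum_(a | a \notin S) \sum_(v | v \notin S)
      (a \in small_edge D S) * (v \in small_edge D (a |: S)) <= E S.
    rewrite exchange_big.
    by apply: leq_trans (sub_sum _ _) _; apply: leq_sum => v _; apply: sub_sum.
  apply: leq_trans.
    apply: leq_sum => a _; apply: leq_sum => v _; exact: (double_pivotal_le D).
  under eq_bigr => a _ do rewrite !big_split.
  rewrite !big_split /= !mul2n -!addnn; apply: leq_add; apply: leq_add => //.
    exact: leq_trans le3 (le_E S).
  exact: leq_trans le4 (le_E S).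
rewrite -sumF -sum_draws !big_distrr -big_split /=.
by apply: leq_sum => S _; rewrite muln1.
Qed.

(** * Binomial bounds for missing a large set *)

Lemma large_miss_countE D i :
  large_miss_count D i
  = \sum_(w | D < #|N w|) #|N w| * 'C(#|V| - #|N w|, i).
Proof.
transitivity (\sum_(S : {set V} | #|S| == i) \sum_(w | D < #|N w|) \sum_v
    [disjoint S & N w] * (v \in N w)).
  by apply: eq_bigr => S _; apply: exchange_big.
rewrite exchange_big; apply: eq_bigr => w _ /=.
rewrite -sum_draws_disjoint big_distrr /=; apply: eq_bigr => S _.
by rewrite -big_distrr -big_mkcond sum1_card mulnC.
Qed.

(** Pascal's rule adds ['C(n.-1, i.-1)] to ['C(n.-1, i)], and past the middle the former is at least
    the latter. *)
Lemma bin_pred_half n i : 0 < i -> n <= i.*2 -> 2 * 'C(n.-1, i) <= 'C(n, i).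
Proof.
case: i => // i _; case: n => [|n] le_ni; first by rewrite bin0n.
rewrite mul2n -addnn binS leq_add2l /=.
have := mul_bin_left n i; have: n - i <= i.+1 by lia.
move=> le_i e; rewrite -(leq_pmul2l (ltn0Sn i)) e leq_mul2r le_i.
by rewrite orbT.
Qed.

Lemma bin_sub_expn2 n d i :
  0 < i -> n <= i.*2 -> 2 ^ d * 'C(n - d, i) <= 'C(n, i).
Proof.
move=> i0 le_ni; elim: d => [|d IHd]; first by rewrite mul1n subn0.
apply: leq_trans IHd; rewrite expnSr -mulnA leq_mul2l subnS.
by rewrite bin_pred_half ?orbT //; apply: leq_trans le_ni; apply: leq_subr.
Qed.

(** Equivalently, [d / 2 ^ d] does not increase for [d >= 1]; among sets larger than [D], the worst
    bound is therefore the one at size [D.+1]. *)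
Lemma mul_expn2_mono d e : 0 < d <= e -> e * 2 ^ d <= d * 2 ^ e.
Proof.
case/andP=> d0; elim: e => [|e IHe]; first by case: d d0.
rewrite leq_eqVlt => /orP[/eqP<- //|]; rewrite ltnS => le_de.
by have := IHe le_de; have := leq_pexp2l (isT : 0 < 2) le_de; rewrite expnS; nia.
Qed.

Lemma large_miss_count_le D i :
  #|V| <= i.*2 ->
  2 ^ D.+1 * large_miss_count D i <= #|V| * D.+1 * 'C(#|V|, i).
Proof.
move=> le_ni; rewrite large_miss_countE big_distrr /=.
apply: (@leq_trans (\sum_(w | D < #|N w|) D.+1 * 'C(#|V|, i))); last first.
  by rewrite sum_nat_const -mulnA leq_mul2r max_card orbT.
apply: leq_sum => w Dw; rewrite mulnA.
have le1 := @mul_expn2_mono D.+1 #|N w| Dw.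
have i0 : 0 < i.
  by rewrite -double_gt0; apply: leq_trans le_ni; apply/card_gt0P; exists w.
have le2 := @bin_sub_expn2 #|V| #|N w| i i0 le_ni.
apply: (@leq_trans (D.+1 * 2 ^ #|N w| * 'C(#|V| - #|N w|, i))).
  by rewrite leq_mul2r [X in X <= _]mulnC le1 orbT.
by rewrite -mulnA leq_mul2l le2.
Qed.

Lemma hit_count_le_succ i : i.*2 < #|V| -> hit_count i <= hit_count i.+1.
Proof.
move=> lt_in; have := hit_count_succ (_ : i <= #|V|).
have : i.+1 <= #|V| - i by lia.
by move=> le_i /(_ ltac:(lia)) e; rewrite -(leq_pmul2l (ltn0Sn i)) e; nia.
Qed.

(** * Descents of the hit counts when all the sets share a vertex *)

Section CommonVertex.
Variables (u : V).
Hypothesis mem_u : forall w, u \in N w.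

(** A set that misses some [N w] avoids [u], and at most half of the [i]-sets avoid [u]. *)
Lemma bin_le_hit_count i : #|V| <= i.*2 -> 'C(#|V|, i) <= 2 * hit_count i.
Proof.
move=> le_ni; have i0 : 0 < i.
  by rewrite -double_gt0; apply: leq_trans le_ni; apply/card_gt0P; exists u.
have := bin_pred_half i0 le_ni.
suff : 'C(#|V|, i) <= hit_count i + 'C(#|V|.-1, i) by lia.
have -> : #|V|.-1 = #|V| - #|[set u]| by rewrite cards1 subn1.
rewrite -sum_draws -sum_draws_disjoint -big_split /=.
apply: leq_sum => S _; case: (boolP (hits S)) => [_|/hitsPn[w dw]]; first exact: leq_addr.
have -> // : [disjoint S & [set u]] by apply: disjointWr dw; rewrite sub1set.
Qed.

Lemma miss_count_le i :
  #|V| <= i.*2 -> 2 * (\sum_(S : {set V} | #|S| == i) ~~ hits S) <= 'C(#|V|, i).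
Proof.
move=> /bin_le_hit_count; rewrite -sum_draws.
suff -> : \sum_(S : {set V} | #|S| == i) 1
    = hit_count i + \sum_(S : {set V} | #|S| == i) ~~ hits S by lia.
by rewrite -big_split; apply: eq_bigr => S _; case: (hits S).
Qed.

Variable L : nat.
Hypothesis ltVL : #|V| < 2 ^ L.+1.
Hypothesis leL : 4 * (2 * L).+1 <= 2 ^ L.

(** For [D = 2 * L] the factor [2 ^ D.+1] is [2 ^ L * 2 ^ L.+1]: the second power absorbs [#|V|],
    the first absorbs [4 * D.+1]. *)
Lemma large_miss_count_small i :
  #|V| <= i.*2 -> 4 * large_miss_count (2 * L) i <= 'C(#|V|, i).
Proof.
move=> /(large_miss_count_le (2 * L)) le1.
have e : 2 ^ (2 * L).+1 = 2 ^ L * 2 ^ L.+1 by rewrite -expnD; congr (_ ^ _); lia.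
rewrite {}e in le1; set h := large_miss_count _ _ in le1 *.
rewrite -(@leq_pmul2l (2 ^ L * 2 ^ L.+1)) ?muln_gt0 ?expn_gt0 //.
rewrite mulnCA; apply: leq_trans (_ : 4 * (#|V| * (2 * L).+1 * 'C(#|V|, i)) <= _).
  by rewrite leq_mul2l le1 orbT.
by rewrite !mulnA leq_mul2r; apply/orP; right; nia.
Qed.

Lemma hit_count_gt_succ i :
  i <= #|V| -> #|V| + 2 * L <= i.*2 -> hit_count i.+1 < hit_count i.
Proof.
move=> le_in le_ni; have le_ni2 : #|V| <= i.*2 by lia.
have C_gt0 : 0 < 'C(#|V|, i) by rewrite bin_gt0.
have := hit_count_succ le_in; have := pivot_count_le (2 * L) i.
have := large_miss_count_small le_ni2; have := bin_le_hit_count le_ni2.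
have := miss_count_le le_ni2.
set X := \sum_(S | _) _; set h := large_miss_count _ _; set C := 'C(_, _) in C_gt0 *.
set d := hit_count i; set d' := hit_count i.+1; set Q := pivot_count i.
move=> leX led leh leQ e.
rewrite -(ltn_pmul2l (ltn0Sn i)) e.
(* From [X <= C / 2] and [h <= C / 4]. With [C <= 2 * d] this gives [Q <= (2 * L + 1 / 2) * d], and
   [0 < d] makes the next bound strict. *)
have {}leQ : 4 * Q <= (4 * L).+1 * C by nia.
have : Q < (2 * L).+1 * d by nia.
have -> : i.+1 = (#|V| - i) + (i.*2.+1 - #|V|) by lia.
have : (2 * L).+1 <= i.*2.+1 - #|V| by lia.
nia.
Qed.

(* Writing s_i = 2 i + 1 - #|V|, one has
   (i + 1) (d_{i+1} - d_i) = Q_i - s_i d_i, so a descent at i says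
   Q_i <= s_i d_i. After division by 'C(#|V|, i), the left side grows by at most
   1 from i to i + 1, and the right side by at least 2 * (1 / 2), because s grows
   by 2 and a common vertex of all N w gives 2 d >= 'C. *)
Lemma hit_count_descent_succ i :
  i < #|V| -> #|V| <= i.*2 -> 16 * (L * L) <= #|V| - i ->
  hit_count i.+1 <= hit_count i -> hit_count i.+2 <= hit_count i.+1.
Proof.
move=> lt_in le_ni leLL.
have e0 := hit_count_succ (ltnW lt_in); have e1 := hit_count_succ lt_in.
have leQ := pivot_count_succ (ltnW lt_in).
have leR := double_pivot_count_le (2 * L) i.
have le_ni1 : #|V| <= i.+1.*2 by lia.
have leh := large_miss_count_small le_ni1; have led := bin_le_hit_count le_ni1.
have eC := mul_bin_left #|V| i.
move: e0 e1 leQ leR leh led eC.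
set Q := pivot_count i; set Q' := pivot_count i.+1.
set R := double_pivot_count i; set h := large_miss_count _ _.
set d := hit_count i; set d' := hit_count i.+1; set d'' := hit_count i.+2.
set C := 'C(_, i); set C' := 'C(_, i.+1).
move=> e0 e1 leQ leR leh led eC le_d.
set k := #|V| - i in leLL e0 leQ eC *; set s := i.*2.+1 - #|V|.
have ek : k + s = i.+1 by rewrite /k /s; lia.
(* Each of the two terms bounding [R] is at most [k * C / 2]: [8 * (L * L) * C] because
   [16 * (L * L) <= k], and [2 * (i.+1 * h)] because [4 * h <= C'] and [i.+1 * C' = k * C]. *)
have leRC : R <= k * C.
  have : 4 * (i.+1 * h) <= k * C by rewrite -eC; nia.
  have : 16 * (L * L) * C <= k * C by rewrite leq_mul2r leLL orbT.
  nia.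
have leQs : Q <= s * d.
  have : i.+1 * d' <= i.+1 * d by rewrite leq_mul2l le_d orbT.
  by rewrite e0 -ek mulnDl leq_add2l.
have leQ's : Q' <= s.+2 * d'.
  rewrite -(leq_pmul2l (ltn0Sn i)); apply: leq_trans leQ _.
  apply: (@leq_trans (k * (s * d) + k * C)).
    by apply: leq_add => //; rewrite leq_mul2l leQs orbT.
  (* Here [k * d <= i.+1 * d'] bounds the first term, and [k * C = i.+1 * C' <= i.+1 * (2 * d')] the
     second. *)
  rewrite -eC mulnCA (mulnCA i.+1) -addn2 mulnDl; apply: leq_add.
    by rewrite leq_mul2l e0 leq_addr orbT.
  by rewrite mulnCA leq_mul2l led orbT.
rewrite -(leq_pmul2l (ltn0Sn i.+1)) e1.
have -> : i.+2 = (#|V| - i.+1) + s.+2 by rewrite /s; lia.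
by rewrite mulnDl leq_add2l.
Qed.

End CommonVertex.
End HittingSets.

(** * Single-crossing sequences and the numerical threshold *)

Lemma mode_of_single_crossing (a : nat -> nat) (n lo hi : nat) :
  (lo <= hi <= n)%N ->
  (forall i, (i < lo)%N -> (a i <= a i.+1)%N) ->
  (forall i, (lo <= i < hi)%N -> (a i.+1 <= a i)%N -> (a i.+2 <= a i.+1)%N) ->
  (forall i, (hi <= i <= n)%N -> (a i.+1 < a i)%N) ->
  exists2 k, (lo <= k <= hi)%N &
    [/\ forall i, (i < k)%N -> (a i <= a i.+1)%N,
        forall i, (k <= i <= n)%N -> (a i.+1 <= a i)%N
      & (a k.+1 < a k)%N].
Proof.
case/andP=> le_lohi le_hin up cross down.
have exk : exists k, (a k.+1 < a k)%N by exists hi; apply: down; rewrite leqnn.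
(* The first strict descent serves as the mode: minimality gives the ascent before it, and [cross],
   then [down], propagate the descent after it. *)
case: (ex_minnP exk) => k lt_k min_k.
have le_khi : (k <= hi)%N by apply: min_k; apply: down; rewrite leqnn.
have le_lok : (lo <= k)%N by rewrite leqNgt; apply/negP => /up; rewrite leqNgt lt_k.
exists k; first by rewrite le_lok.
split=> //.
  by move=> i lt_ik; rewrite leqNgt; apply/negP => /min_k; rewrite leqNgt lt_ik.
move=> i /andP[]; elim: i => [|i IHi] le_ki le_in.
  by move: le_ki; rewrite leqn0 => /eqP e; rewrite -e ltnW.
move: le_ki; rewrite leq_eqVlt => /orP[/eqP <-|]; first exact: ltnW.
rewrite ltnS => le_ki.
have [lt_ihi|le_hii] := ltnP i hi.
  by apply: cross (IHi le_ki (ltnW le_in)); rewrite (leq_trans le_lok).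
by apply: ltnW; apply: down; rewrite le_in leqW.
Qed.

(** Source of the threshold [2 ^ 13]: the inequality fails at [L = 12]. It keeps
    [16 * (L * L) <= n - i] throughout the window where descents must propagate. *)
Lemma leq_quadratic_expn2 L :
  (13 <= L)%N -> (32 * (L * L) + 2 * L + 2 <= 2 ^ L)%N.
Proof.
elim: L => // L IHL; rewrite leq_eqVlt => /orP[/eqP <- //|].
by rewrite ltnS => le13; have := IHL le13; rewrite expnS; nia.
Qed.

(** * Domination as hitting closed neighbourhoods, and the coefficients *)

Section DominationAsHitting.
Variables (V : finType) (adj : rel V).
Hypothesis adj_sym : symmetric adj.
Local Notation nbhd := (fun w => closed_nbhd adj [set w]).

Lemma in_closed_nbhd1 v w : (v \in closed_nbhd adj [set w]) = (v == w) || adj w v.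
Proof.
rewrite !inE; congr (_ || _); apply/existsP/idP => [[x]|awv].
  by rewrite inE => /andP[/eqP ->].
by exists w; rewrite inE eqxx.
Qed.

Lemma dominating_hits (S : {set V}) : dominating adj S = hits nbhd S.
Proof.
rewrite /dominating eqEsubset subsetT /=; apply/subsetP/forallP => [domS w|hitS w _].
  apply/pred0Pn; have := domS w (in_setT w); rewrite inE => /orP[wS|].
    by exists w; rewrite /= wS in_closed_nbhd1 eqxx.
  case/existsP=> x /andP[xS axw]; exists x.
  by rewrite /= xS in_closed_nbhd1 adj_sym axw orbT.
have /pred0Pn[x /andP[/= xS]] := hitS w; rewrite in_closed_nbhd1 inE.
case/orP=> [/eqP <-|awx]; first by rewrite xS.
by apply/orP; right; apply/existsP; exists x; rewrite xS adj_sym.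
Qed.

Lemma dom_count_hit_count i : dom_count adj i = hit_count nbhd i.
Proof.
rewrite /dom_count /hit_count -big_mkcondr sum1dep_card /=.
by apply: eq_card => S; rewrite !inE dominating_hits andbC.
Qed.

Lemma universal_mem_closed_nbhd u w :
  universal adj u -> u \in closed_nbhd adj [set w].
Proof.
move/eqP => uT; have : w \in closed_nbhd adj [set u] by rewrite uT inE.
by rewrite !in_closed_nbhd1 eq_sym adj_sym.
Qed.

(** The sum in [dom_poly] starts at index 1, so the coefficient at 0 must be matched separately; on
    an empty vertex type the empty set would dominate. *)
Lemma dom_count0 : (0 < #|V|)%N -> dom_count adj 0 = 0%N.
Proof.
case/card_gt0P=> x _; apply/eqP; rewrite cards_eq0; apply/eqP/setP => S.
rewrite !inE cards_eq0; apply/negbTE; rewrite negb_and orbC.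
case: eqP => //= ->; apply/eqP => /setP/(_ x).
by rewrite !inE /= => /existsP[y]; rewrite inE.
Qed.

Lemma dom_count_card : dom_count adj #|V| = 1%N.
Proof.
rewrite -(cards1 [set: V]); apply: eq_card => S; rewrite !inE.
rewrite [RHS]eqEcard subsetT cardsT /=.
apply/andP/idP => [[_ /eqP-> //]|le_VS].
have -> : S = setT by apply/eqP; rewrite eqEcard subsetT cardsT.
by rewrite cardsT; split => //; apply/eqP/setP => v; rewrite !inE.
Qed.

Lemma dom_count_gt_card i : (#|V| < i)%N -> dom_count adj i = 0%N.
Proof.
move=> lt_Vi; apply/eqP; rewrite cards_eq0; apply/eqP/setP => S.
rewrite !inE; apply/negbTE; rewrite negb_and orbC neq_ltn.
by rewrite (leq_ltn_trans (max_card _) lt_Vi).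
Qed.

Lemma coef_dom_poly i : (0 < #|V|)%N -> (dom_poly adj)`_i = (dom_count adj i)%:R.
Proof.
move=> V0; rewrite /dom_poly coef_sum.
under eq_bigr => j _ do rewrite coefZ coefXn.
have [i_in|] := boolP (i \in index_iota 1 #|V|.+1).
  rewrite (bigD1_seq i) ?iota_uniq //= eqxx mulr1 big1 ?addr0 // => j ne_ji.
  by rewrite eq_sym (negbTE ne_ji) mulr0.
move=> i_out; rewrite big_seq big1; last first.
  move=> j j_in; case: eqP => [e|]; last by rewrite mulr0.
  by rewrite e j_in in i_out.
move: i_out; rewrite mem_index_iota negb_and -!leqNgt leqn0 => /orP[/eqP->|lt_Vi].
  by rewrite dom_count0.
by rewrite dom_count_gt_card.
Qed.

Lemma size_dom_poly : (0 < #|V|)%N -> size (dom_poly adj) = #|V|.+1.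
Proof.
move=> V0; apply/eqP; rewrite eqn_leq; apply/andP; split.
  by apply/leq_sizeP => i lt_Vi; rewrite coef_dom_poly // dom_count_gt_card.
rewrite ltnNge; apply/negP => /leq_sizeP/(_ _ (leqnn _)).
by rewrite coef_dom_poly // dom_count_card.
Qed.

End DominationAsHitting.

(** * The mode and its location *)

Lemma is_mode_strict (R : numDomainType) (f : {poly R}) k :
  unimodal_at f k -> f`_k.+1 < f`_k -> is_mode f k.
Proof.
move=> uk lt_k; split=> // j [_ up _]; rewrite leqNgt; apply/negP => /up.
by rewrite (lt_geF lt_k).
Qed.

Lemma trunc_log2_le_log2 (R : realType) n :
  (0 < n)%N -> (trunc_log 2 n)%:R <= log2 (n%:R : R).
Proof.
move=> n0; have ln2 : 0 < ln 2 :> R by rewrite ln_gt0 ?ltr1n.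
rewrite /log2 ler_pdivlMr // mulr_natl -lnXn ?ltr0n //.
by rewrite ler_ln ?posrE ?exprn_gt0 ?ltr0n // -natrX ler_nat trunc_logP.
Qed.

Unset Implicit Arguments.
Set Strict Implicit.

Theorem theorem1p2 (R : realType) (n : nat) (V : finType) (adj : rel V)
    (adj_sym : symmetric adj) (adj_irr : irreflexive adj)
    (cardV : #|V| = n) (n_ge : (2 ^ 13 <= n)%N)
    (has_universal : exists v : V, universal adj v) :
  unimodal (dom_poly adj) /\
  exists k : nat, is_mode (dom_poly adj) k /\
    n%:R / 2 <= k%:R :> R /\
    k%:R <= n%:R / 2 + log2 (n%:R : R) + 2.
Proof.
case: has_universal => u univ_u.
have n0 : (0 < n)%N by apply: leq_trans n_ge.
have V0 : (0 < #|V|)%N by rewrite cardV.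
set L := trunc_log 2 n.
have le13 : (13 <= L)%N by apply: trunc_log_max.
have leL := leq_quadratic_expn2 le13.
have le_expLn : (2 ^ L <= n)%N by apply: trunc_logP.
have ltVL : (#|V| < 2 ^ L.+1)%N by rewrite cardV trunc_log_ltn.
have leL4 : (4 * (2 * L).+1 <= 2 ^ L)%N by nia.
have mem_u w : u \in closed_nbhd adj [set w] by apply: universal_mem_closed_nbhd.
have coefE i := coef_dom_poly adj i V0.
(* The window starts at the least [i] with [n <= 2 * i] and ends at the least [i] with
   [n + 2 * L <= 2 * i]. *)
have [|i lt_i|i lt_i|i lt_i|k /andP[le_lok le_khi] [up down lt_k]] :=
  @mode_of_single_crossing (dom_count adj) n (uphalf n) (uphalf n + L).
- by apply/andP; split; lia.
- by rewrite !dom_count_hit_count //; apply: hit_count_le_succ; rewrite cardV; lia.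
- rewrite !dom_count_hit_count //.
  by apply: (hit_count_descent_succ mem_u ltVL leL4); rewrite cardV; lia.
- rewrite !dom_count_hit_count //.
  by apply: (hit_count_gt_succ mem_u ltVL leL4); rewrite cardV; lia.
have unik : unimodal_at (dom_poly adj) k.
  split; rewrite ?size_dom_poly ?cardV //=; first by lia.
    by move=> i lt_ik; rewrite !coefE ler_nat up.
  by move=> i /andP[le_ki lt_in]; rewrite !coefE ler_nat down // le_ki ltnW.
split; first by exists k.
exists k; split; first by apply: is_mode_strict; rewrite // !coefE ltr_nat.
have le_log := trunc_log2_le_log2 R n0; rewrite -/L in le_log.
split.
  by rewrite ler_pdivrMr ?ltr0n // -natrM ler_nat; lia.
(* The extra 1 comes from rounding [n / 2] up when [n] is odd. *)
have le_k : k%:R * 2 <= n%:R + L%:R * 2 + 1 :> R.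
  by rewrite -!natrM -natrD natr1 ler_nat; lia.
lra.
Qed.
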